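(* Let $c\colon X\rightsquigarrow Y$ be a channel, let $\omega\in\mathcal{D}(X)$, and let $\psi\in\mathcal{M}(Y)$ be a multiset of size $K=\|\psi\|\geq1$. Then Jeffrey's update $c^\dagger_\omega{}_*\,\mathrm{flrn}(\psi)$ is the distribution $\omega'\in\mathcal{D}(X)$ for which $\mathrm{mn}[K](\omega')$ diverges minimally from the multinomial update: \[ \operatorname*{argmin}_{\omega'\in\mathcal{D}(X)} D_{KL}\Big(\mathrm{mn}[K](\omega)\big|_{\mathcal{M}[K](c)^*\mathbf{1}_\psi},\;\mathrm{mn}[K](\omega')\Big)=c^\dagger_\omega{}_*\,\mathrm{flrn}(\psi). \]
   Context: Distributions and multisets. \begin{itemize} \item $\mathcal{D}(X)$ denotes finitely supported probability distributions. \item $\mathcal{M}(X)$ denotes finitely supported multisets $\varphi\colon X\to\mathbb{N}$, with size $\|\varphi\|=\sum_x\varphi(x)$; $\mathcal{M}[K](X)$ is the set of multisets of size $K$. \item $\mathrm{flrn}(\varphi)(x)=\varphi(x)/\|\varphi\|$. \item The multinomial distribution is \[ \mathrm{mn}[K](\omega)(\varphi)=\frac{K!}{\prod_x\varphi(x)!}\prod_x\omega(x)^{\varphi(x)}. \] \end{itemize} Channels. \begin{itemize} \item A channel $c\colon X\rightsquigarrow Y$ is a function $X\to\mathcal{D}(Y)$. \item The pushforward is $(c_*\omega)(y)=\sum_x\omega(x)c(x)(y)$, and a function $f$ acts as the channel $x\mapsto1|f(x)\rangle$. \item Kleisli composition is $(d\circ c)(x)=d_*(c(x))$. \end{itemize}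 Extended multiset functor. $\mathcal{M}[K](c)\colon\mathcal{M}[K](X)\rightsquigarrow\mathcal{M}[K](Y)$ is the Kleisli composite $\mathrm{acc}\circ c^K\circ\mathrm{arr}$, where: \begin{itemize} \item $c^K(x_1,\dots,x_K)(y_1,\dots,y_K)=\prod_ic(x_i)(y_i)$; \item $\mathrm{acc}(x_1,\dots,x_K)=\sum_i1|x_i\rangle$; \item $\mathrm{arr}(\varphi)$ is uniform on $\mathrm{acc}^{-1}(\varphi)$, each element having probability $\prod_x\varphi(x)!/K!$. \end{itemize} Predicates. \begin{itemize} \item $\mathbf{1}_\psi$ is the point predicate at $\psi$. \item The pullback is $(d^*q)(a)=\sum_bd(a)(b)q(b)$. \item Conditioning is $\sigma|_p(a)=\sigma(a)p(a)/\sum_{a'}\sigma(a')p(a')$, defined when the denominator is non-zero. \end{itemize} Dagger and divergence. \begin{itemize} \item $c^\dagger_\omega(y)(x)=\omega(x)c(x)(y)/(c_*\omega)(y)$. \item $D_{KL}(\sigma,\rho)=\sum_a\sigma(a)\ln(\sigma(a)/\rho(a))$. \end{itemize} *)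

(* Defs.v *)
From HB Require Import structures.
From mathcomp Require Import all_boot all_order all_algebra.
From mathcomp Require Import finmap multiset.
From mathcomp Require Import all_classical all_reals all_analysis.

Set Implicit Arguments.
Unset Strict Implicit.
Unset Printing Implicit Defensive.

Import Order.TTheory GRing.Theory Num.Theory.

Local Open Scope classical_set_scope.
Local Open Scope ring_scope.

(* Distributions, channels and predicates are represented by plain real-valued
   functions, those in D(T) being singled out by the set [distr]. The sums
   [\sum_(x \in A) F x] range over the support of F, which is finite in every
   use below. *)

Section Channels.
Variable R : realType.

Definition distr (T : choiceType) : set (T -> R) :=
  [set w | [/\ forall x, 0 <= w x,
               finite_set [set x | w x != 0]
             & \sum_(x \in [set: T]) w x = 1]].

Definition channel (S T : choiceType) (c : S -> T -> R) : Prop :=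
  forall x, distr (c x).

Definition push (S T : choiceType) (c : S -> T -> R) (w : S -> R) : T -> R :=
  fun y => \sum_(x \in [set: S]) w x * c x y.

Definition fun_channel (S T : choiceType) (f : S -> T) : S -> T -> R :=
  fun x y => (f x == y)%:R.

Definition kleisli (S T U : choiceType) (d : T -> U -> R) (c : S -> T -> R) :
  S -> U -> R := fun x => push d (c x).

Definition point_pred (T : choiceType) (b : T) : T -> R := fun a => (a == b)%:R.

Definition pull (S T : choiceType) (d : S -> T -> R) (q : T -> R) : S -> R :=
  fun a => \sum_(b \in [set: T]) d a b * q b.

Definition validity (T : choiceType) (s p : T -> R) : R :=
  \sum_(a \in [set: T]) s a * p a.

Definition conditioning (T : choiceType) (s p : T -> R) : T -> R :=
  fun a => s a * p a / validity s p.

(* Since division by 0 yields 0, [dagger c w y] is the zero function when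
   [push c w y = 0]; it is a distribution for every other y. *)
Definition dagger (S T : choiceType) (c : S -> T -> R) (w : S -> R) :
  T -> S -> R := fun y x => w x * c x y / push c w y.

(* The usual conventions: 0 ln (0 / r) = 0, and s ln (s / 0) = +oo for s > 0,
   so that the divergence is +oo unless the support of s lies in that of r. *)
Definition kl_term (s r : R) : \bar R :=
  if s == 0 then 0%E else if r == 0 then +oo%E else (s * ln (s / r))%:E.

Definition DKL (T : choiceType) (s r : T -> R) : \bar R :=
  (\sum_(a \in [set: T]) kl_term (s a) (r a))%E.

Definition argmin (T : Type) (A : set T) (f : T -> \bar R) : set T :=
  [set x | A x /\ forall y, A y -> (f x <= f y)%E].

End Channels.

Arguments fun_channel R {S T} f _ _.
Arguments point_pred R {T} b _.

Section Multisets.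
Local Open Scope mset_scope.

Definition msize (X : choiceType) (phi : {mset X}) : nat :=
  (\sum_(x <- finsupp phi) phi x)%N.

Record mset_of_size (K : nat) (X : choiceType) := MsetOfSize {
  mset_val :> {mset X};
  _ : msize mset_val == K }.

HB.instance Definition _ (K : nat) (X : choiceType) :=
  [isSub for @mset_val K X].
HB.instance Definition _ (K : nat) (X : choiceType) :=
  [Choice of mset_of_size K X by <:].

Lemma msize_seq_mset (K : nat) (X : choiceType) (t : K.-tuple X) :
  msize (seq_mset t) == K.
Proof.
apply/eqP; rewrite -[RHS](size_tuple t) -(perm_size (perm_eq_seq_mset t)).
by rewrite size_mset.
Qed.

Definition acc (K : nat) (X : choiceType) (t : K.-tuple X) : mset_of_size K X :=
  MsetOfSize (msize_seq_mset t).

Definition mfact (X : choiceType) (phi : {mset X}) : nat :=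
  (\prod_(x <- finsupp phi) (phi x)`!)%N.

Variable R : realType.

Definition flrn (X : choiceType) (phi : {mset X}) : X -> R :=
  fun x => (phi x)%:R / (msize phi)%:R.

Definition mn (K : nat) (X : choiceType) (w : X -> R) : mset_of_size K X -> R :=
  fun phi => (K`!)%:R / (mfact phi)%:R *
             \prod_(x <- finsupp (mset_val phi)) w x ^+ mset_val phi x.

Definition arr (K : nat) (X : choiceType) : mset_of_size K X -> K.-tuple X -> R :=
  fun phi t => if acc t == phi then (mfact phi)%:R / (K`!)%:R else 0.

Definition tuple_channel (K : nat) (X Y : choiceType) (c : X -> Y -> R) :
  K.-tuple X -> K.-tuple Y -> R :=
  fun t u => \prod_(i < K) c (tnth t i) (tnth u i).

Definition mset_channel (K : nat) (X Y : choiceType) (c : X -> Y -> R) :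
  mset_of_size K X -> mset_of_size K Y -> R :=
  kleisli (fun_channel R (@acc K Y))
          (kleisli (@tuple_channel K X Y c) (@arr K X)).

End Multisets.

Arguments flrn R {X} phi _.
Arguments mn {R} K {X} w _.
Arguments arr R {K X} _ _.
Arguments tuple_channel {R} K {X Y} c _ _.
Arguments mset_channel {R} K {X Y} c _ _.

(* Main.v *)
Require Import Defs.
From HB Require Import structures.
From mathcomp Require Import all_boot all_order all_algebra.
From mathcomp Require Import finmap multiset.
From mathcomp Require Import all_classical all_reals all_analysis.
From mathcomp Require Import ring.

Set Implicit Arguments.
Unset Strict Implicit.
Unset Printing Implicit Defensive.

Import Order.TTheory GRing.Theory Num.Theory.

Local Open Scope classical_set_scope.
Local Open Scope ring_scope.


(* Write s for the multinomial update, i.e. mn[K](omega) conditioned on psi.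
   Since ln (mn[K](w)(phi)) is, up to a term that does not involve w, equal to
   sum_x phi(x) ln w(x), the divergence D(s, mn[K](w)) depends on w only through
   the mean of s. If that mean is K w0, then
     D(s, mn[K](w)) - D(s, mn[K](w0)) = K D(w0, w),
   and Gibbs' inequality makes w0 the unique minimiser.
   To compute the mean, lift s to pairs (f, g) of tuples with acc(g) = psi,
   weighted by prod_i omega(f_i) c(f_i)(g_i): given g the coordinates of f are
   independent, and f_j is distributed as the dagger at g_j. Averaging over j
   gives K times Jeffrey's update, whatever g is. *)

(** Converts a finitely supported sum into a big operator over a finite type, where products
    distribute over sums. *)
Lemma fsum_inj (R : nmodType) (I : finType) (T : choiceType) (h : I -> T)
    (F : T -> R) :
  injective h -> (forall t, F t != 0 -> exists i, t = h i) ->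
  \sum_(t \in [set: T]) F t = \sum_i F (h i).
Proof.
move=> h_inj F_supp.
rewrite -(@fsbig_widen _ _ _ _ (h @` [set: I])) //; last first.
  move=> t [_ nht] /=; apply/eqP; case: (eqVneq (F t) 0) => // /F_supp [i ti].
  by case: nht; exists i.
rewrite fsbig_image; last by move=> i j _ _ /h_inj.
rewrite [RHS]fsbig_seq ?index_enum_uniq//; apply: eq_fsbigl.
by apply/seteqP; split=> i //= _; rewrite mem_index_enum.
Qed.

(** * Sums over tuples and their accumulated multisets *)

Section Tuples.
Variables (R : realType) (K : nat) (X : choiceType).
Implicit Types (S : {fset X}) (t : K.-tuple X) (phi : mset_of_size K X).

(** Finite functions stand in for tuples because [bigA_distr_bigA] is stated for them; values in a
    finite [S] make the index type finite. *)
Definition ffun_tuple S (f : {ffun 'I_K -> S}) : K.-tuple X :=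
  [tuple val (f i) | i < K].

Lemma ffun_tuple_inj S : injective (@ffun_tuple S).
Proof.
move=> f g /(congr1 (fun t => tnth t)) fg; apply/ffunP => i; apply: val_inj.
by have := congr1 (@^~ i) fg; rewrite !tnth_mktuple.
Qed.

Lemma fsum_tuple S (F : K.-tuple X -> R) :
  (forall t, F t != 0 -> forall i, tnth t i \in S) ->
  \sum_(t \in [set: K.-tuple X]) F t
  = \sum_(f : {ffun 'I_K -> S}) F (ffun_tuple f).
Proof.
move=> F_supp; apply: fsum_inj => [|t Ft]; first exact: ffun_tuple_inj.
exists [ffun i => [` F_supp t Ft i]%fset]; apply: eq_from_tnth => i.
by rewrite tnth_mktuple ffunE.
Qed.

Lemma mem_acc t i : tnth t i \in finsupp (mset_val (acc t)).
Proof. by rewrite msuppE (perm_mem (perm_eq_seq_mset t)) mem_tnth. Qed.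

Lemma acc_count t x : mset_val (acc t) x = (\sum_(i < K) (tnth t i == x))%N.
Proof.
rewrite [LHS]mset_seqE -sum1_count big_tuple big_mkcond/=.
by apply: eq_bigr => i _; case: eqP.
Qed.

Lemma sum_acc t (F : X -> R) :
  \sum_(x <- finsupp (mset_val (acc t))) (mset_val (acc t) x)%:R * F x
  = \sum_(i < K) F (tnth t i).
Proof.
rewrite -[RHS](big_tuple _ _ t predT F).
rewrite -(perm_big _ (perm_eq_seq_mset t)) big_mset /=.
by apply: eq_bigr => x _; rewrite mulr_natl Monoid.iteropE iter_addr_0.
Qed.

Lemma prod_acc t (F : X -> R) :
  \prod_(x <- finsupp (mset_val (acc t))) F x ^+ mset_val (acc t) x
  = \prod_(i < K) F (tnth t i).
Proof.
rewrite -[RHS](big_tuple _ _ t predT F).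
by rewrite -(perm_big _ (perm_eq_seq_mset t)) big_mset.
Qed.

End Tuples.

(** * Gibbs' inequality and the finiteness of the divergence *)

Section Divergence.
Variable R : realType.

Lemma ln_prod (I : eqType) (r : seq I) (F : I -> R) :
  (forall i, i \in r -> 0 < F i) ->
  ln (\prod_(i <- r) F i) = \sum_(i <- r) ln (F i).
Proof.
elim: r => [|i r IHr] F_gt0; first by rewrite !big_nil ln1.
have Fr_gt0 j : j \in r -> 0 < F j by move=> jr; rewrite F_gt0 // inE jr orbT.
rewrite !big_cons lnM ?IHr // posrE; first by rewrite F_gt0 ?mem_head.
by rewrite big_seq prodr_gt0.
Qed.

(** This is [expR t >= 1 + t] at [t = ln b - ln a], multiplied by [a], with strict inequality for
    [t != 0]. For [a = 0] it reduces to [- b <= 0]. *)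
Lemma gibbs_term (a b : R) : 0 <= a -> 0 <= b -> (a != 0 -> b != 0) ->
  a - b <= a * (ln a - ln b) ?= iff (a == b).
Proof.
move=> a_ge0 b_ge0 ab; split; last first; have [a0|a_neq0] := eqVneq a 0.
- by rewrite a0 mul0r sub0r oppr_eq0 eq_sym.
- have a_gt0 : 0 < a by rewrite lt_def a_neq0.
  have b_gt0 : 0 < b by rewrite lt_def ab.
  have [->|a_neq_b] := eqVneq a b; first by rewrite !subrr mulr0 eqxx.
  apply/negbTE; rewrite lt_eqF //.
  have l_neq0 : ln b - ln a != 0.
    by rewrite subr_eq0; apply: contraNneq a_neq_b => /ln_inj ->.
  have := expR_gt1Dx l_neq0; rewrite expRB !lnK ?posrE // ltr_pdivlMr //.
  by rewrite mulrDl mul1r -ltrBrDl => h; rewrite -[ltRHS]opprK -ltrNr opprB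
     -mulrN opprB mulrC.
- by rewrite a0 mul0r sub0r oppr_le0.
- have a_gt0 : 0 < a by rewrite lt_def a_neq0.
  have b_gt0 : 0 < b by rewrite lt_def ab.
  have := expR_ge1Dx (ln b - ln a); rewrite expRB !lnK ?posrE // ler_pdivlMr //.
  by rewrite mulrDl mul1r -lerBrDl => h; rewrite -[leRHS]opprK -lerNr opprB
     -mulrN opprB mulrC.
Qed.

Lemma distr_sum (T : choiceType) (w : T -> R) (A : {fset T}) :
  distr w -> (forall x, w x != 0 -> x \in A) -> \sum_(x <- A) w x = 1.
Proof.
move=> [_ _ <-] wA; rewrite (fsbigTE A) // => x xA; apply/eqP.
by apply: contraNT xA => /wA.
Qed.

(** Summing [gibbs_term] gives the bound, since [w - v] has total mass 0 on [A]; the termwise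
    equality cases combine to [v = w]. *)
Lemma gibbs (T : choiceType) (w v : T -> R) (A : {fset T}) :
  distr w -> distr v ->
  (forall x, w x != 0 -> x \in A) -> (forall x, v x != 0 -> x \in A) ->
  (forall x, w x != 0 -> v x != 0) ->
  0 <= \sum_(x <- A) w x * (ln (w x) - ln (v x)) ?= iff `[< v = w >].
Proof.
move=> dw dv wA vA wv; have [[w_ge0 _ _] [v_ge0 _ _]] := (dw, dv).
have {1}-> : 0 = \sum_(x <- A) (w x - v x) :> R.
  by rewrite big_split sumrN /= !distr_sum // subrr.
rewrite !big_seq_fsetE /=.
have -> : `[< v = w >] = [forall (x : A | true), w (val x) == v (val x)].
  apply/asboolP/forall_inP => [-> //|vw]; apply/funext => x.
  have [xA|xA] := boolP (x \in A); first by apply/esym/eqP/(vw [` xA]%fset).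
  by apply/eqP; move: (contraNN (@vA x) xA) (contraNN (@wA x) xA);
    rewrite !negbK => /eqP -> /eqP ->.
by apply: leif_sum => x _; apply: gibbs_term => //; exact: wv.
Qed.

Lemma DKL_EFin (T : choiceType) (s r : T -> R) (A : {fset T}) :
  (forall a, s a != 0 -> a \in A) -> (forall a, s a != 0 -> r a != 0) ->
  DKL s r = (\sum_(a <- A) s a * ln (s a / r a))%:E.
Proof.
move=> sA sr; rewrite /DKL (fsbigTE A) => [|a aA].
  rewrite -sumEFin; apply: eq_bigr => a _; rewrite /kl_term.
  by have [->|/sr/negPf ->//] := eqVneq (s a) 0; rewrite mul0r.
by rewrite /kl_term ifT //; apply: contraNT aA => /sA.
Qed.

(** No term is [-oo], so a single [+oo] term decides the sum. *)
Lemma DKL_pinfty (T : choiceType) (s r : T -> R) (A : {fset T}) (a : T) :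
  (forall a, s a != 0 -> a \in A) -> s a != 0 -> r a = 0 -> DKL s r = +oo%E.
Proof.
move=> sA sa ra; rewrite /DKL (fsbigTE A) => [|b bA].
  apply/esum_eqyP => [b _|].
    by rewrite /kl_term; case: ifP => // _; case: ifP.
  by exists a; split; [exact: sA| |rewrite /kl_term (negPf sa) ra eqxx].
by rewrite /kl_term ifT //; apply: contraNT bA => /sA.
Qed.

End Divergence.

(** * Projection onto the multinomial distributions by matching means *)

Section Projection.
Variables (R : realType) (K : nat) (X : choiceType).
Implicit Types (phi : mset_of_size K X) (w v : X -> R).

Lemma mfact_gt0 (phi : {mset X}%mset) : (0 < mfact phi)%N.
Proof. by apply: prodn_gt0 => x; exact: fact_gt0. Qed.

Lemma multinomial_coef_gt0 phi : 0 < (K`!)%:R / (mfact phi)%:R :> R.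
Proof. by rewrite divr_gt0 // ltr0n ?fact_gt0 ?mfact_gt0. Qed.

Lemma mn_ge0 w phi : (forall x, 0 <= w x) -> 0 <= mn K w phi.
Proof.
move=> w_ge0; rewrite mulr_ge0 ?(ltW (multinomial_coef_gt0 _)) //.
by apply: prodr_ge0 => x _; rewrite exprn_ge0.
Qed.

Lemma mn_neq0P w phi :
  reflect (forall x, x \in finsupp (mset_val phi) -> w x != 0)
          (mn K w phi != 0).
Proof.
rewrite /mn mulf_eq0 (gt_eqF (multinomial_coef_gt0 _)) /= prodf_seq_neq0.
apply: (iffP allP) => wphi x xphi; have := wphi x xphi => /=.
  by rewrite expf_eq0 lt0n -mem_finsupp xphi.
by rewrite expf_eq0 => /negPf ->; rewrite andbF.
Qed.

(** A range [A] independent of [phi] lets this sum be exchanged with one over multisets; elements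
    outside [phi] contribute 0 whatever [ln (w x)] is. *)
Lemma ln_mn w phi (A : {fset X}) : (forall x, 0 <= w x) -> mn K w phi != 0 ->
  (forall x, w x != 0 -> x \in A) ->
  ln (mn K w phi) = ln ((K`!)%:R / (mfact phi)%:R) +
    \sum_(x <- A) (mset_val phi x)%:R * ln (w x).
Proof.
move=> w_ge0 /mn_neq0P wphi wA.
have w_gt0 x : x \in finsupp (mset_val phi) -> 0 < w x.
  by move=> /wphi; rewrite lt_def w_ge0 andbT.
have wX_gt0 x : x \in finsupp (mset_val phi) -> 0 < w x ^+ mset_val phi x.
  by move=> /w_gt0; apply: exprn_gt0.
rewrite /mn lnM ?posrE ?multinomial_coef_gt0 ?ln_prod //; last first.
  by rewrite big_seq prodr_gt0.
congr (_ + _); rewrite -[RHS](@big_fset_incl _ _ _ _ (finsupp (mset_val phi))).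
- rewrite !big_seq; apply: eq_bigr => x /w_gt0 wx.
  by rewrite lnXn // mulr_natl.
- by apply/fsubsetP => x /wphi /wA.
- by move=> x _ /fsfun_dflt ->; rewrite mul0r.
Qed.

(** Multinomials form an exponential family, so the closest one to [s] is found by matching the mean
    of [s]. *)
Lemma DKL_mn_argmin (s : mset_of_size K X -> R) (A : {fset mset_of_size K X})
    w :
  (0 < K)%N -> (forall phi, 0 <= s phi) ->
  (forall phi, s phi != 0 -> phi \in A) ->
  distr w ->
  (forall x, \sum_(phi <- A) s phi * (mset_val phi x)%:R = K%:R * w x) ->
  argmin (@distr R X) (fun v => DKL s (mn K v)) = [set w].
Proof.
move=> K_gt0 s_ge0 sA dw mean.
have w_ge0 : forall x, 0 <= w x by case: dw.
have KR_gt0 : 0 < K%:R :> R by rewrite ltr0n.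
have mean_neq0 phi x : s phi != 0 -> x \in finsupp (mset_val phi) -> w x != 0.
  move=> sphi xphi; rewrite -(inj_eq (mulfI (lt0r_neq0 KR_gt0))) mulr0 -mean.
  rewrite psumr_neq0 => [|phi' _]; last by rewrite mulr_ge0.
  apply/hasP; exists phi; first exact: sA.
  by rewrite /= lt_def mulf_neq0 ?mulr_ge0 // pnatr_eq0 -mem_finsupp.
have sw phi : s phi != 0 -> mn K w phi != 0.
  by move=> sphi; apply/mn_neq0P => x; apply: mean_neq0.
(* Pythagorean identity: the excess [d] at [v] is [K] times the divergence of [w] from [v], which
   vanishes only for [v = w]. *)
have gap v : distr v -> (forall phi, s phi != 0 -> mn K v phi != 0) ->
    exists d : R, DKL s (mn K v) = (DKL s (mn K w) + d%:E)%E
      /\ 0 <= d ?= iff `[< v = w >].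
  move=> dv sv; have v_ge0 : forall x, 0 <= v x by case: dv.
  pose B := (fset_set [set x | w x != 0] `|` fset_set [set x | v x != 0])%fset.
  have wB x : w x != 0 -> x \in B.
    by move=> wx; rewrite inE in_fset_set ?mem_set //; case: dw.
  have vB x : v x != 0 -> x \in B.
    by move=> vx; rewrite inE orbC in_fset_set ?mem_set //; case: dv.
  (* If [w x] is nonzero, so is the mean at [x]: some multiset in the support of [s] contains [x],
     and its probability under [mn K v] would vanish if [v x] did. *)
  have wv x : w x != 0 -> v x != 0.
    rewrite -(inj_eq (mulfI (lt0r_neq0 KR_gt0))) mulr0 -mean.
    rewrite psumr_neq0 => [|phi' _]; last by rewrite mulr_ge0.
    move=> /hasP[phi _ /andP[_]] /=; rewrite lt_def mulf_eq0 negb_or.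
    move=> /andP[/andP[/sv/mn_neq0P vphi]]; rewrite pnatr_eq0 => phix _.
    by apply: vphi; rewrite mem_finsupp.
  exists (K%:R * \sum_(x <- B) w x * (ln (w x) - ln (v x))); split; last first.
    have [sum_ge0 <-] := gibbs dw dv wB vB wv.
    split; first by rewrite mulr_ge0 // ltW.
    by rewrite -[X in X == _](mulr0 K%:R) (inj_eq (mulfI (lt0r_neq0 KR_gt0))).
  rewrite (DKL_EFin sA sv) (DKL_EFin sA sw) -EFinD; congr EFin.
  (* The multinomial coefficient is common to [mn K w] and [mn K v] and cancels in the difference of
     logarithms. *)
  transitivity (\sum_(phi <- A) (s phi * ln (s phi / mn K w phi) +
     \sum_(x <- B) s phi * (mset_val phi x)%:R * (ln (w x) - ln (v x)))).
    apply: eq_bigr => phi _; have [->|sphi] := eqVneq (s phi) 0.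
      by rewrite !mul0r big1 ?addr0 // => x _; rewrite !mul0r.
    have pos (u : X -> R) : (forall x, 0 <= u x) -> mn K u phi != 0 ->
        mn K u phi \is Num.pos.
      by move=> u_ge0 u0; rewrite posrE lt_def u0 mn_ge0.
    have s_pos : s phi \is Num.pos by rewrite posrE lt_def sphi s_ge0.
    rewrite !ln_div ?pos ?sw ?sv //.
    rewrite (ln_mn w_ge0 (sw _ sphi) wB) (ln_mn v_ge0 (sv _ sphi) vB).
    under [X in _ = _ + X]eq_bigr do rewrite -mulrA mulrBr.
    by rewrite -mulr_sumr sumrB; ring.
  rewrite big_split exchange_big /= mulr_sumr; congr (_ + _).
  by apply: eq_bigr => x _; rewrite -mulr_suml mean mulrA.
apply/seteqP; split=> [v [dv vmin]|_ ->]; last first.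
  split=> // v dv.
  have [sv|] := pselect (forall phi, s phi != 0 -> mn K v phi != 0).
    by have [d [-> [d_ge0 _]]] := gap v dv sv; rewrite leeDl // lee_fin.
  move=> /existsNP[phi /not_implyP[sphi /negP]]; rewrite negbK => /eqP vphi.
  by rewrite (DKL_pinfty sA sphi vphi) leey.
(* Since [w] competes with finite divergence, a minimiser [v] has finite divergence too, and its
   excess [d] is at most 0. *)
have /vmin := dw => vw.
have [sv|] := pselect (forall phi, s phi != 0 -> mn K v phi != 0).
  have [d [vE [d_ge0 d0]]] := gap v dv sv.
  apply/asboolP; rewrite -d0 eq_le d_ge0.
  move: vw; rewrite vE (DKL_EFin sA sw) -EFinD lee_fin.
  by rewrite gerDl.
move=> /existsNP[phi /not_implyP[sphi /negP]]; rewrite negbK => /eqP vphi.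
by move: vw; rewrite (DKL_pinfty sA sphi vphi) (DKL_EFin sA sw).
Qed.

End Projection.

(** * The multinomial update and its mean, computed on pairs of tuples *)

Section JeffreyUpdate.
Variables (R : realType) (X Y : choiceType) (c : X -> Y -> R) (omega : X -> R).
Variables (K : nat) (psi : mset_of_size K Y).
Hypotheses (c_channel : channel c) (omega_distr : distr omega).

Let S := fset_set [set x | omega x != 0].
Let T := finsupp (mset_val psi).
Let update phi :=
  mn K omega phi * pull (mset_channel K c) (point_pred R psi) phi.

(** The probability that [K] independent pairs with law [omega x * c x y] have first components [f]
    and second components accumulating to [psi]. *)
Definition jeffrey_weight (f : {ffun 'I_K -> S}) : R :=
  \sum_(g : {ffun 'I_K -> T} | acc (ffun_tuple g) == psi)
    \prod_(i < K) (omega (val (f i)) * c (val (f i)) (val (g i))).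

Let omega_ge0 x : 0 <= omega x. Proof. by case: omega_distr. Qed.

Let c_ge0 x y : 0 <= c x y. Proof. by case: (c_channel x). Qed.

Let mem_S x : (x \in S) = (omega x != 0).
Proof.
case: omega_distr => _ fin _; rewrite in_fset_set //.
by apply/idP/idP => [/set_mem|?]; [|exact/mem_set].
Qed.

Let sum_S y : \sum_(x <- S) omega x * c x y = push c omega y.
Proof.
rewrite /push (fsbigTE S) // => x.
by rewrite mem_S negbK => /eqP ->; rewrite mul0r.
Qed.

Lemma pull_point_pred (U V : choiceType) (d : U -> V -> R) b a :
  pull d (point_pred R b) a = d a b.
Proof.
rewrite /pull (fsbigTE [fset b]%fset) => [|b'].
  by rewrite big_seq_fset1 /point_pred eqxx mulr1.
by rewrite !inE /point_pred => /negPf ->; rewrite mulr0.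
Qed.

(** The coefficient in [mn] cancels the uniform probability in [arr], leaving independent draws from
    [omega]. *)
Lemma mn_arr phi (t : K.-tuple X) : mn K omega phi * arr R phi t
  = if acc t == phi then \prod_(i < K) omega (tnth t i) else 0.
Proof.
rewrite /arr; case: eqP => [<-|_]; last by rewrite mulr0.
rewrite /mn prod_acc mulrAC mulrA divfK ?divff ?mul1r // pnatr_eq0 -lt0n.
exact: mfact_gt0.
Qed.

Lemma updateE phi :
  update phi = \sum_(f | acc (ffun_tuple f) == phi) jeffrey_weight f.
Proof.
rewrite /update pull_point_pred /mset_channel /kleisli /push.
(* Only tuples accumulating to [psi] contribute, and their entries lie in [T]. *)
rewrite (@fsum_tuple _ _ _ T) => [|u]; last first.
  rewrite /fun_channel; case: (acc u =P psi) => [upsi _ i|_].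
    by rewrite /T -upsi mem_acc.
  by rewrite mulr0 eqxx.
rewrite mulr_sumr exchange_big [RHS]big_mkcond /=; apply: eq_bigr => g _.
rewrite /fun_channel; case: eqP => _; last by rewrite !mulr0.
rewrite mulr1 mulr_fsumr (@fsum_tuple _ _ _ S) => [|t]; last first.
  rewrite mulrA mn_arr; case: (acc t =P phi) => _; last by rewrite mul0r eqxx.
  rewrite mulf_eq0 negb_or => /andP[/prodf_neq0 t_neq0 _] i.
  by rewrite mem_S t_neq0.
rewrite [RHS]big_mkcond; apply: eq_bigr => f _.
rewrite mulrA mn_arr; case: eqP => _; last by rewrite mul0r.
by rewrite -big_split; apply: eq_bigr => i _; rewrite !tnth_mktuple.
Qed.

Let A := [fset acc (ffun_tuple f) | f : {ffun 'I_K -> S}]%fset.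

Let mem_A (f : {ffun 'I_K -> S}) : acc (ffun_tuple f) \in A.
Proof. by rewrite /A; apply/imfsetP; exists f. Qed.

Lemma update_supp phi : update phi != 0 -> phi \in A.
Proof.
rewrite updateE; apply: contraNT => phiA; rewrite big1 // => f /eqP fphi.
by move: phiA; rewrite -fphi mem_A.
Qed.

(** Change of variables along [acc]: each [f] contributes to exactly one multiset, and [A] contains
    it. *)
Lemma sum_update (H : mset_of_size K X -> R) :
  \sum_(phi <- A) update phi * H phi
  = \sum_f jeffrey_weight f * H (acc (ffun_tuple f)).
Proof.
under eq_bigr do rewrite updateE mulr_suml.
rewrite (exchange_big_dep xpredT) //=; apply: eq_bigr => f _.
rewrite (big_rem (acc (ffun_tuple f))) ?mem_A //= eqxx.
rewrite big1_seq ?addr0 // => phi /andP[/eqP <-].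
by rewrite mem_rem_uniq ?fset_uniq // inE eqxx.
Qed.

Lemma update_ge0 phi : 0 <= update phi.
Proof.
rewrite updateE; apply: sumr_ge0 => f _; apply: sumr_ge0 => g _.
by apply: prodr_ge0 => i _; rewrite mulr_ge0.
Qed.

Lemma validity_updateE :
  validity (mn K omega) (pull (mset_channel K c) (point_pred R psi))
  = \sum_f jeffrey_weight f.
Proof.
rewrite /validity (fsbigTE A) => [|phi phiA]; last first.
  by apply/eqP; apply: contraNT phiA; apply: update_supp.
transitivity (\sum_(phi <- A) update phi * 1).
  by apply: eq_bigr => phi _; rewrite mulr1.
by rewrite (sum_update (fun=> 1)); apply: eq_bigr => f _; rewrite mulr1.
Qed.

(** For fixed [g] the coordinates of [f] are independent, so each is summed out on its own. *)
Lemma sum_jeffrey_weight : \sum_f jeffrey_weight f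
  = \sum_(g : {ffun 'I_K -> T} | acc (ffun_tuple g) == psi)
      \prod_(i < K) push c omega (val (g i)).
Proof.
rewrite exchange_big; apply: eq_bigr => g _ /=.
rewrite -(bigA_distr_bigA
  (fun i (x : S) => omega (val x) * c (val x) (val (g i)))).
by apply: eq_bigr => i _; rewrite -sum_S big_seq_fsetE.
Qed.

(** Every [g] accumulating to [psi] takes the value [y] somewhere, so a zero of the pushforward at
    [y] would kill every product in the total weight. *)
Lemma push_neq0 : \sum_f jeffrey_weight f != 0 ->
  forall y, y \in T -> push c omega y != 0.
Proof.
move=> V_neq0 y yT; apply: contraNneq V_neq0 => Py.
rewrite sum_jeffrey_weight big1 // => g /eqP gpsi; apply/eqP.
have : y \in finsupp (mset_val (acc (ffun_tuple g))) by rewrite gpsi.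
rewrite msuppE (perm_mem (perm_eq_seq_mset _)) => /tnthP[i].
rewrite tnth_mktuple => yi.
by apply/prodf_eq0; exists i => //; rewrite -yi Py.
Qed.

(** Fixing [f j = x] changes only the factor at [j], from the pushforward at [g j] to
    [omega x * c x (g j)], which is that pushforward times the dagger. *)
Lemma sum_coord (g : {ffun 'I_K -> T}) (j : 'I_K) x :
  push c omega (val (g j)) != 0 ->
  \sum_(f : {ffun 'I_K -> S})
     (\prod_(i < K) (omega (val (f i)) * c (val (f i)) (val (g i))))
     * (val (f j) == x)%:R
  = (\prod_(i < K) push c omega (val (g i))) * dagger c omega (val (g j)) x.
Proof.
(* The indicator is absorbed into factor [j], so that the summand is again a product over
   coordinates. *)
move=> Pj; pose b i (z : S) := omega (val z) * c (val z) (val (g i))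
  * (if i == j then (val z == x)%:R else 1).
transitivity (\sum_(f : {ffun 'I_K -> S}) \prod_(i < K) b i (f i)).
  apply: eq_bigr => f _; rewrite [RHS]big_split /=; congr (_ * _).
  by rewrite -big_mkcond big_pred1_eq.
rewrite -bigA_distr_bigA (bigD1 j) //= [in RHS](bigD1 j) //=.
rewrite mulrAC; congr (_ * _); last first.
  apply: eq_bigr => i /negPf ij; rewrite -sum_S big_seq_fsetE /=.
  by apply: eq_bigr => z _; rewrite /b ij mulr1.
rewrite /dagger [RHS]mulrC divfK //.
have -> : \sum_z b j z = \sum_(z <- S) omega z * c z (val (g j)) * (z == x)%:R.
  by rewrite big_seq_fsetE; apply: eq_bigr => z _; rewrite /b eqxx.
have [xS|] := boolP (x \in S).
  rewrite (big_rem x) //= eqxx mulr1 big1_seq ?addr0 // => z.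
  rewrite /= mem_rem_uniq ?fset_uniq // inE => /andP[/negPf -> _].
  by rewrite mulr0.
rewrite mem_S negbK => /eqP x0; rewrite x0 mul0r big1 // => z _.
by case: eqP => [->|_]; rewrite ?x0 ?mul0r ?mulr0.
Qed.

Let J := push (dagger c omega) (flrn R (mset_val psi)).

Lemma jeffreyE x :
  J x = \sum_(y <- T) (mset_val psi y)%:R / K%:R * dagger c omega y x.
Proof.
rewrite /J /push (fsbigTE T) => [|y /fsfun_dflt y0]; last first.
  by rewrite /flrn y0 !mul0r.
by rewrite /flrn (eqP (valP psi)).
Qed.

Hypotheses (K_gt0 : (0 < K)%N) (V_neq0 : \sum_f jeffrey_weight f != 0).

Let KR_neq0 : K%:R != 0 :> R. Proof. by rewrite pnatr_eq0 -lt0n. Qed.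

(** The count of [x] is a sum of indicators over the coordinates, and [sum_coord] evaluates each of
    them. *)
Lemma sum_jeffrey_weight_count x :
  \sum_f jeffrey_weight f * (mset_val (acc (ffun_tuple f)) x)%:R
  = (\sum_f jeffrey_weight f) * (K%:R * J x).
Proof.
under eq_bigr do rewrite mulr_suml.
rewrite exchange_big sum_jeffrey_weight mulr_suml.
apply: eq_bigr => g /eqP gpsi.
transitivity (\sum_(j < K) (\prod_(i < K) push c omega (val (g i)))
    * dagger c omega (val (g j)) x).
  under eq_bigr do rewrite acc_count natr_sum mulr_sumr.
  rewrite exchange_big; apply: eq_bigr => j _ /=.
  rewrite -sum_coord; last by apply: push_neq0 => //; exact: valP.
  by apply: eq_bigr => f _; rewrite tnth_mktuple.
rewrite -mulr_sumr; congr (_ * _).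
(* The sum over [j] depends on [g] only through its accumulated multiset [psi], hence is the same
   for every [g]. *)
transitivity (\sum_(j < K) dagger c omega (tnth (ffun_tuple g) j) x).
  by apply: eq_bigr => j _; rewrite tnth_mktuple.
rewrite -(sum_acc _ (dagger c omega ^~ x)) gpsi jeffreyE mulr_sumr.
by apply: eq_bigr => y _; rewrite [RHS]mulrA [K%:R * _]mulrC divfK.
Qed.

(** The dagger at [y] has mass 1 where the pushforward is nonzero, which [push_neq0] ensures on the
    support of [psi]. *)
Lemma jeffrey_distr : distr J.
Proof.
have J_supp x : x \notin S -> J x = 0.
  rewrite mem_S negbK jeffreyE => /eqP x0; apply: big1 => y _.
  by rewrite /dagger x0 !mul0r mulr0.
split=> [x||].
- rewrite jeffreyE sumr_ge0 // => y _.
  rewrite mulr_ge0 ?divr_ge0 ?ler0n ?mulr_ge0 // -sum_S sumr_ge0 // => z _.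
  by rewrite mulr_ge0.
- apply: (@sub_finite_set _ _ [set` S]); last exact: finite_fset.
  by move=> x /=; apply: contraNT => /J_supp ->.
rewrite (fsbigTE S) //; under eq_bigr do rewrite jeffreyE.
rewrite exchange_big big_seq /= (eq_bigr (fun y => (mset_val psi y)%:R / K%:R)).
  rewrite -big_seq -mulr_suml -natr_sum.
  by rewrite [X in X%:R](eqP (valP psi)) divff.
by move=> y yT; rewrite -mulr_sumr -mulr_suml sum_S divff ?mulr1 // push_neq0.
Qed.

Lemma argmin_DKL_update :
  argmin (@distr R X)
    (fun v => DKL (conditioning (mn K omega)
        (pull (mset_channel K c) (point_pred R psi))) (mn K v))
  = [set J].
Proof.
have V_ge0 : 0 <= \sum_f jeffrey_weight f.
  rewrite -validity_updateE /validity fsumr_ge0 // => phi _.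
  exact: update_ge0.
apply: (@DKL_mn_argmin _ _ _ _ A) => //.
- move=> phi; rewrite /conditioning validity_updateE divr_ge0 //.
  exact: update_ge0.
- move=> phi; rewrite /conditioning mulf_eq0 negb_or => /andP[].
  by move/update_supp.
- exact: jeffrey_distr.
(* The total weight is both the normaliser of the update and a factor of its unnormalised mean, so
   it cancels. *)
move=> x; rewrite /conditioning validity_updateE.
under eq_bigr do rewrite mulrAC.
rewrite -mulr_suml (sum_update (fun phi => (mset_val phi x)%:R)).
by rewrite sum_jeffrey_weight_count mulrAC divff // mul1r.
Qed.

End JeffreyUpdate.

Theorem theorem8p5 (R : realType) (X Y : choiceType)
    (c : X -> Y -> R) (omega : X -> R) (K : nat) (psi : mset_of_size K Y)
    (c_channel : channel c) (omega_distr : distr omega) (K_ge1 : (1 <= K)%N)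
    (update_defined :
       validity (mn K omega) (pull (mset_channel K c) (point_pred R psi)) != 0) :
  argmin (@distr R X)
    (fun omega' : X -> R =>
       DKL (conditioning (mn K omega)
              (pull (mset_channel K c) (point_pred R psi)))
           (mn K omega'))
  = [set push (dagger c omega) (flrn R psi)].
Proof.
apply: argmin_DKL_update => //.
by rewrite -validity_updateE.
Qed.
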